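(* Let $R\ge2$ be an integer and assume $X\in L^{2R}(\mathbf P)$. If $f:\mathbf R\to\mathbf R$ is Lipschitz continuous and $2R$ times differentiable with $f^{(k)}$ bounded for $k=R,\dots,2R$, then the nested Monte Carlo family $(Y_h)_{h\in\mathcal H}$, $Y_0$ satisfies $(SE_\beta)$ with $\beta=1$ and $(WE_{\alpha,\bar R})$ with $\alpha=1$ and $\bar R=R-1$.
   Context: Nested Monte Carlo setting. $(X,Y)$ is a pair of $\mathbf R\times\mathbf R^{q_Y}$-valued random variables on a probability space $(\Omega,\mathcal A,\mathbf P)$ with $X\in L^2(\mathbf P)$. There exist a Borel function $F:\mathbf R^{q_Z}\times\mathbf R^{q_Y}\to\mathbf R$ and a random variable $Z:\Omega\to\mathbf R^{q_Z}$ independent of $Y$ such that $X=F(Z,Y)$. Let $(Z_k)_{k\ge1}$ be an i.i.d. sequence of copies of $Z$, independent of $Y$. Put $\mathcal H=\{1/K:\ K\ge1\text{ integer}\}$ and $$Y_0=f\big(\mathbf E[X\mid Y]\big),\qquad Y_{1/K}=f\Big(\frac1K\sum_{k=1}^KF(Z_k,Y)\Big),\quad K\ge1.$$ (The family $Y_h$, $h\in\mathcal H\cup\{0\}$, should not be confused with the random variable $Y$.) $(SE_\beta)$: there is $V_1\ge0$ with $\mathbf E|Y_h-Y_0|^2\le V_1h^\beta$ for all $h\in\mathcal H$. $(WE_{\alpha,\bar R})$ (with integer $\bar R\ge1$): there are real $c_1,\dots,c_{\bar R}$ and a function $\eta_{\bar R}$ on $\mathcal H$ with $\mathbf E[Y_h]=\mathbf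 E[Y_0]+\sum_{k=1}^{\bar R}c_kh^{\alpha k}+h^{\alpha\bar R}\eta_{\bar R}(h)$ for $h\in\mathcal H$ and $\lim_{h\to0}\eta_{\bar R}(h)=0$. *)

(* Defs.v *)
From HB Require Import structures.
From mathcomp Require Import all_boot all_order all_algebra finmap.
From mathcomp Require Import all_classical all_reals all_analysis.

Set Implicit Arguments.
Unset Strict Implicit.
Unset Printing Implicit Defensive.

Import Order.TTheory GRing.Theory Num.Theory.
Import numFieldNormedType.Exports.

Local Open Scope classical_set_scope.
Local Open Scope ring_scope.

Section independence.
Context d (T : measurableType d) (R : realType) (P : probability T R).

Definition independent_systems (F G : set (set T)) :=
  forall A B, F A -> G B -> P (A `&` B) = (P A * P B)%E.

Definition independent_RVs d1 (T1 : measurableType d1) d2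
    (T2 : measurableType d2) (X : {RV P >-> T1}) (Y : {RV P >-> T2}) :=
  independent_systems (g_sigma_algebra_preimage X) (g_sigma_algebra_preimage Y).

Definition mutually_independent_RVs d1 (T1 : measurableType d1)
    (Zs : nat -> {RV P >-> T1}) :=
  forall (J : {fset nat}) (B : nat -> set T1), (forall k, measurable (B k)) ->
  P (\bigcap_(k in [set` J]) (Zs k @^-1` B k)) =
  (\prod_(k <- J) P (Zs k @^-1` B k))%E.

Definition iid_copies d1 (T1 : measurableType d1)
    (Zs : nat -> {RV P >-> T1}) (Z : {RV P >-> T1}) :=
  mutually_independent_RVs Zs /\
  forall k B, measurable B -> distribution P (Zs k) B = distribution P Z B.

(* The sequence as a whole, not merely each of its terms, is independent of
   [Y]. *)
Definition sequence_independent_of d1 (T1 : measurableType d1) d2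
    (T2 : measurableType d2) (Zs : nat -> {RV P >-> T1}) (Y : {RV P >-> T2}) :=
  independent_systems <<s \bigcup_k g_sigma_algebra_preimage (Zs k) >>
                      (g_sigma_algebra_preimage Y).

End independence.

(* [C] is a version of the conditional expectation E[X | Y]. *)
Definition is_cond_expectation d (T : measurableType d) (R : realType)
    (P : probability T R) d2 (T2 : measurableType d2) (X : {RV P >-> R})
    (Y : {RV P >-> T2}) (C : T -> R) :=
  [/\ C \in Lfun P 1%E,
      measurable_fun [set: g_sigma_algebra_preimageType Y] C &
      forall A, g_sigma_algebra_preimage Y A ->
        (\int[P]_(w in A) (C w)%:E = \int[P]_(w in A) (X w)%:E)%E].

Section errors.
Context d (T : measurableType d) (R : realType) (P : probability T R).

Definition steps : set R := [set h | exists2 K : nat, (0 < K)%N & h = K%:R^-1].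

(* A family (Y_h), h in H u {0}, is a function of [h : R]; its values at the
   other reals are irrelevant. *)
Implicit Type Yfam : R -> T -> R.

(* Measurability (resp. integrability) is part of the two conditions below,
   because 'E_P is a total operator. *)
Definition strong_error Yfam (beta : R) :=
  (forall h, (steps `|` [set 0]) h -> measurable_fun [set: T] (Yfam h)) /\
  exists2 V1 : R, 0 <= V1 &
    forall h, steps h ->
      ('E_P[fun w => (`|Yfam h w - Yfam 0%R w| ^+ 2)%R] <=
       (V1 * h `^ beta)%:E)%E.

Definition weak_error Yfam (alpha : R) (Rbar : nat) :=
  (forall h, (steps `|` [set 0]) h -> Yfam h \in Lfun P 1%E) /\
  exists (c : nat -> R) (eta : R -> R),
    (forall h, steps h ->
      ('E_P[Yfam h] = 'E_P[Yfam 0%R] +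
        (\sum_(1 <= k < Rbar.+1) c k * h `^ (alpha * k%:R)
         + h `^ (alpha * Rbar%:R) * eta h)%:E)%E) /\
    (eta h @[h --> within steps (nbhs (0 : R))] --> (0 : R)).

End errors.

(* The inner copies Z_1, Z_2, ... are [Zs 0], [Zs 1], ...;
   [C] is a version of E[X | Y]. *)
Definition is_nested_family (R : realType) (T S1 S2 : Type) (f : R -> R)
    (F : S1 * S2 -> R) (Zs : nat -> T -> S1) (Y : T -> S2) (C : T -> R)
    (Yfam : R -> T -> R) :=
  (forall w, Yfam 0 w = f (C w)) /\
  (forall K : nat, (0 < K)%N -> forall w,
     Yfam K%:R^-1 w = f (K%:R^-1 * \sum_(k < K) F (Zs k w, Y w))).

(* Main.v *)
Require Import Defs.
From HB Require Import structures.
From mathcomp Require Import all_boot all_order all_algebra finmap.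
From mathcomp Require Import all_classical all_reals all_analysis.
From mathcomp Require Import measurable_realfun zify ring.
Import Order.TTheory GRing.Theory Num.Theory.
Import numFieldNormedType.Exports.
Local Open Scope classical_set_scope.
Local Open Scope ring_scope.

(* Let g(y) = E[F(Z, y)], so that E[X | Y] = g(Y) almost surely, let
   H(z, y) = F(z, y) - g(y) and S_K = H(Z_1, Y) + ... + H(Z_K, Y); then
   Y_(1/K) = f(g(Y) + S_K / K).  The Lipschitz bound and E[S_K^2] = O(K) give the
   strong error.  For the weak error, expand f at g(Y) to order 2R.  Since
   Z_(K+1) is independent of (S_K, Y), the binomial formula for
   (S_K + H(Z_(K+1), Y))^m shows that E[G(Y) S_(K+1)^m] - E[G(Y) S_K^m] only
   involves E[G(Y) mu_i(Y) S_K^(m-i)] with i >= 2, where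
   mu_i(y) = E[H(Z, y)^i]: the term i = 1 vanishes because H is centered.  By
   induction on m, E[G(Y) S_K^m] is therefore a polynomial in K of degree at most
   m/2, so K^-m E[f^(m)(g(Y)) S_K^m] is a polynomial in 1/K divisible by
   K^-(m - m/2), and the remainder, of order m = 2R, is O(K^-R). *)

(** * Taylor remainder and growth of derivatives *)

(** Both signs of [t] are covered, and [|c| <= |t|] lets a bound that increases with [|c|] be
    carried over to [t]. *)
Lemma mvt_origin {R : realType} (g : R -> R) (t : R) :
  (forall x, derivable g x 1) ->
  exists2 c, `|c| <= `|t| & g t - g 0 = derive1 g c * t.
Proof.
move=> dg.
have isd (x : R) : is_derive x 1 g (derive1 g x).
  by rewrite derive1E; apply/derivableP/dg.
have cg A : {within A, continuous g}.
  apply: continuous_subspaceT => x.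
  exact/differentiable_continuous/derivable1_diffP/dg.
have [t0|t0] := leP 0 t.
  have [c + ->] := @MVT_segment _ g (derive1 g) 0 t t0 (fun x _ => isd x) (cg _).
  rewrite in_itv/= => /andP[c0 ct]; exists c; last by rewrite subr0.
  by rewrite !ger0_norm.
have [c + e] :=
  @MVT_segment _ g (derive1 g) t 0 (ltW t0) (fun x _ => isd x) (cg _).
rewrite in_itv/= => /andP[tc c0]; exists c.
  by rewrite ler0_norm// ltr0_norm// lerN2.
by rewrite -opprB e sub0r mulrN opprK.
Qed.

Lemma derive1n_succ {R : realType} (f : R -> R) k :
  derive1n k.+1 f = derive1n k (derive1 f).
Proof. by rewrite /derive1n iterSr. Qed.

Lemma is_derive_taylor_poly {R : realType} (a : nat -> R) (n : nat) (t : R) :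
  is_derive t 1 (fun s => \sum_(k < n.+1) a k / k`!%:R * s ^+ k)
    (\sum_(k < n) a k.+1 / k`!%:R * t ^+ k).
Proof.
have -> : (fun s => \sum_(k < n.+1) a k / k`!%:R * s ^+ k) =
    (fun s => (\poly_(k < n.+1) (a k / k`!%:R)).[s]).
  apply/funext => s; rewrite horner_poly.
  by apply: eq_bigr => k _.
have -> : \sum_(k < n) a k.+1 / k`!%:R * t ^+ k =
    ((\poly_(k < n.+1) (a k / k`!%:R))^`()).[t].
  rewrite -[LHS](@horner_poly _ n (fun k => a k.+1 / k`!%:R)).
  congr (_.[t]); apply/polyP => i; rewrite coef_deriv !coef_poly ltnS.
  case: ifP => // _; last by rewrite mul0rn.
  rewrite factS natrM -mulr_natr invfM; field.
  by rewrite nat1r !pnatr_eq0 -lt0n fact_gt0.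
exact: is_derive_poly.
Qed.

(** Induction on [n] through [derive1 f]: the remainder vanishes at [t = 0] and its derivative in
    [t] is the remainder of order [n] of [f'], so the mean value theorem yields one more factor
    [|t|]. The factor [1/n!] is given up, which only affects the constant. *)
Lemma taylor_remainder_le {R : realType} (n : nat) (f : R -> R) (M : R) :
  (forall k, (k < n)%N -> forall x, derivable (derive1n k f) x 1) ->
  (forall x, `|derive1n n f x| <= M) ->
  forall x t, `|f (x + t) - \sum_(k < n) derive1n k f x / k`!%:R * t ^+ k|
              <= M * `|t| ^+ n.
Proof.
elim: n f => [|n IH] f df fM x t.
  by rewrite big_ord0 subr0 expr0 mulr1; exact: fM.
pose g t := f (x + t) - \sum_(k < n.+1) derive1n k f x / k`!%:R * t ^+ k.
have isd (s : R) : is_derive s 1 g (derive1 f (x + s) -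
    \sum_(k < n) derive1n k (derive1 f) x / k`!%:R * s ^+ k).
  apply: is_deriveB; last first.
    rewrite (eq_bigr (fun k : 'I_n => derive1n k.+1 f x / k`!%:R * s ^+ k)).
      exact: (@is_derive_taylor_poly _ (fun k => derive1n k f x) n s).
    by move=> k _; rewrite derive1n_succ.
  have /derivableP d1 := df 0%N isT (x + s).
  have := @is_derive1_comp _ f (fun s => x + s) s _ 1 d1; rewrite derive1E.
  by rewrite mulr1; apply; apply: is_derive_eq; rewrite add0r mulr1.
have dg (s : R) : derivable g s 1 by case: (isd s).
have [c ct] := mvt_origin g t dg.
have -> : g 0 = 0.
  rewrite /g addr0 big_ord_recl expr0 mulr1 fact0 divr1 big1 ?addr0 ?subrr//.
  by move=> i _; rewrite expr0n mulr0.
rewrite -/(g t) subr0 derive1E derive_val => ->.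
rewrite normrM exprSr mulrA ler_wpM2r//.
apply: le_trans (IH (derive1 f) _ _ x c) _.
- by move=> k kn y; rewrite -derive1n_succ; exact: df.
- by move=> y; rewrite -derive1n_succ.
- rewrite ler_wpM2l//; first exact: le_trans (fM 0).
  by rewrite lerXn2r ?nnegrE.
Qed.

(* For k >= r the exponent is the truncated difference r - k = 0. *)
Lemma derive1n_growth {R : realType} (f : R -> R) (r n : nat) :
  (r <= n)%N ->
  (forall k, (k < n)%N -> forall x, derivable (derive1n k f) x 1) ->
  (forall k, (r <= k <= n)%N -> [bounded derive1n k f x | x in [set: R]]) ->
  exists2 M, 0 <= M & forall k, (k <= n)%N ->
    forall x, `|derive1n k f x| <= M * (1 + `|x|) ^+ (r - k).
Proof.
move=> rn df fb.
suff H k : (k <= n)%N -> exists M, forall x,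
    `|derive1n k f x| <= M * (1 + `|x|) ^+ (r - k).
  (* The bound on [k] moves inside the existential so that [choice] applies to all [k]; the sum of
     the [|M k|] is then a constant common to all orders. *)
  have {}H k : exists M, (k <= n)%N -> forall x,
      `|derive1n k f x| <= M * (1 + `|x|) ^+ (r - k).
    by have [/H[M]|] := leqP k n; [exists M|exists 0].
  have [M HM] := choice H.
  exists (\sum_(k < n.+1) `|M k|) => [|k kn x]; first exact: sumr_ge0.
  apply: le_trans (HM _ kn x) _; rewrite ler_wpM2r ?exprn_ge0 ?addr_ge0//.
  rewrite (bigD1 (Ordinal (kn : (k < n.+1)%N)))//= (le_trans (ler_norm _))//.
  by rewrite lerDl sumr_ge0.
have bd k' : (r <= k' <= n)%N -> exists M, forall x,
    `|derive1n k' f x| <= M * (1 + `|x|) ^+ (r - k').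
  move=> /[dup] /andP[rk _] /fb [M0 [M0r Hb]].
  exists (M0 + 1) => x; have := Hb (M0 + 1); rewrite ltrDl ltr01 => /(_ isT x I).
  by move: rk; rewrite -subn_eq0 => /eqP ->; rewrite expr0 mulr1.
move=> kn; have [rk|kr] := leqP r k; first by apply: bd; rewrite rk.
(* Induction on [r - k], that is, downwards in [k] from the bounded order [r]: the mean value
   theorem between 0 and [x] turns growth of degree [i] at order [k.+1] into growth of degree [i.+1]
   at order [k]. *)
elim: {k kn}(r - k)%N {-2}k (erefl (r - k)%N) kr => [|i IH] k rki kr.
  by move: kr; rewrite ltnNge -subn_eq0 rki.
have [M HM] : exists M, forall x,
    `|derive1n k.+1 f x| <= M * (1 + `|x|) ^+ i.
  have rki1 : (r - k.+1)%N = i by rewrite subnS rki.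
  have [rk1|] := leqP r k.+1; last first.
    by move/(IH k.+1 rki1); rewrite rki1.
  by rewrite -rki1; apply: bd; rewrite rk1 (leq_trans kr).
exists (`|derive1n k f 0| + M) => x.
have [c cx e] :=
  mvt_origin (derive1n k f) x (df k (leq_trans kr rn)).
have M0 : 0 <= M by have := HM 0; rewrite normr0 addr0 expr1n mulr1; apply: le_trans.
rewrite -(subrK (derive1n k f 0) (derive1n k f x)) e addrC.
rewrite (le_trans (ler_normD _ _))// mulrDl lerD//.
  by rewrite ler_peMr// exprn_ege1// lerDl.
rewrite normrM rki exprSr mulrA ler_pM//; last by rewrite lerDr.
apply: le_trans (HM c) _; rewrite ler_wpM2l// lerXn2r ?nnegrE ?addr_ge0//.
by rewrite lerD2l.
Qed.

(** * Polynomial sequences in the binomial basis *)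

(* Sequences that are polynomial in K of degree less than p, written in the
   binomial basis, in which discrete integration is a shift. *)
Definition newton {R : comRingType} (p : nat) (A : nat -> R) :=
  exists a : nat -> R, forall K, A K = \sum_(j < p) a j * 'C(K, j)%:R.

Section newton.
Context {R : realType}.
Implicit Types A B : nat -> R.

Lemma newton_le p q A : (p <= q)%N -> newton p A -> newton q A.
Proof.
move=> pq [a Aa]; exists (fun j => if (j < p)%N then a j else 0) => K.
rewrite Aa (big_ord_widen q (fun j => a j * 'C(K, j)%:R))// big_mkcond/=.
by apply: eq_bigr => j _; case: ifP => //; rewrite mul0r.
Qed.

Lemma newton_cst (c : R) : newton 1 (fun=> c).
Proof. by exists (fun=> c) => K; rewrite big_ord1 bin0 mulr1. Qed.

Lemma newtonZ p (c : R) A : newton p A -> newton p (fun K => c * A K).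
Proof.
move=> [a Aa]; exists (fun j => c * a j) => K.
by rewrite Aa mulr_sumr; apply: eq_bigr => j _; rewrite mulrA.
Qed.

Lemma newton_sum p I (s : seq I) (Q : pred I) (A : I -> nat -> R) :
  (forall i, Q i -> newton p (A i)) ->
  newton p (fun K => \sum_(i <- s | Q i) A i K).
Proof.
move=> nA; have : forall i, exists a : nat -> R, Q i ->
    forall K, A i K = \sum_(j < p) a j * 'C(K, j)%:R.
  move=> i; have [/nA[a Aa]|_] := boolP (Q i); [by exists a|by exists (fun=> 0)].
move=> /choice[a Aa]; exists (fun j => \sum_(i <- s | Q i) a i j) => K.
rewrite (eq_bigr _ (fun i Qi => Aa i Qi K)) exchange_big/=.
by apply: eq_bigr => j _; rewrite mulr_suml.
Qed.

(** By Pascal's rule the increment of ['C(K, j.+1)] in [K] is ['C(K, j)], so the coefficients move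
    by one place; [A 0 = 0] makes the constant coefficient 0. *)
Lemma newton_antidiff p A : A 0%N = 0 ->
  newton p (fun K => A K.+1 - A K) -> newton p.+1 A.
Proof.
move=> A0 [a Aa]; exists (fun j => if j is j'.+1 then a j' else 0).
elim=> [|K IH].
  by rewrite A0 big1// => -[[|j] ?] _; rewrite ?mul0r// bin0n mulr0.
rewrite -(subrK (A K) (A K.+1)) Aa IH !big_ord_recl/= !mul0r !add0r.
rewrite -big_split/=; apply: eq_bigr => j _.
by rewrite /bump/= binS natrD mulrDr addrC.
Qed.

Let ffact_prodr K j : (K ^_ j)%:R = \prod_(i < j) (K%:R - i%:R) :> R.
Proof.
elim: j => [|j IH]; first by rewrite big_ord0 ffactn0.
rewrite big_ord_recr/= -IH ffactnSr natrM.
have [jK|Kj] := leqP j K; first by rewrite natrB.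
by rewrite ffact_small// !mul0r.
Qed.

(** [K^-j 'C(K, j)] is [1/j!] times the product of the [1 - i/K] for [i < j], a polynomial in [1/K].
    The remaining factor [K^-(m - j)] is divisible by [K^-s] because [j < p] and
    [s + p <= m + 1]. *)
Lemma newton_inv_poly p m s A : (s + p <= m.+1)%N -> newton p A ->
  exists q : {poly R}, forall K, (0 < K)%N ->
    K%:R^-1 ^+ m * A K = K%:R^-1 ^+ s * q.[K%:R^-1].
Proof.
move=> spm [a Aa].
exists (\sum_(j < p) (a j / j`!%:R) *: ('X^(m - j - s) *
  \prod_(i < j) (1 - i%:R *: 'X))) => K K0.
have Kn0 : (K%:R : R) != 0 by rewrite pnatr_eq0 -lt0n.
rewrite Aa horner_sum !mulr_sumr; apply: eq_bigr => j _.
rewrite hornerZ hornerM hornerXn horner_prod.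
rewrite (eq_bigr (fun i : 'I_j => K%:R^-1 * (K%:R - i%:R))); last first.
  by move=> i _; rewrite !hornerE mulrBr mulVf// mulrC.
rewrite big_split/= prodr_const card_ord -ffact_prodr -bin_ffact natrM.
have jf : (j`!%:R : R) != 0 by rewrite pnatr_eq0 -lt0n fact_gt0.
have -> : K%:R^-1 ^+ m = K%:R^-1 ^+ s * (K%:R^-1 ^+ (m - j - s) * K%:R^-1 ^+ j) :> R.
  by rewrite -!exprD; congr (_ ^+ _); have := ltn_ord j; lia.
by field.
Qed.

End newton.

(** * Averaging out an independent variable *)

Section independent_pair.
Context {d d1 d2 : measure_display} {T : measurableType d}
  {T1 : measurableType d1} {T2 : measurableType d2} {R : realType}
  {P : probability T R} {U : {RV P >-> T1}} {V : {RV P >-> T2}}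
  {mu : probability T1 R}.
Hypothesis UV_indep : independent_RVs U V.
(** [mu] is kept apart from [distribution P U] so that [Z] and all its copies can share one measure
    in the section integrals. *)
Hypothesis U_law : forall B, measurable B -> P (U @^-1` B) = mu B.

Let mUV : measurable_fun [set: T] (fun w => (U w, V w)).
Proof. exact: measurable_fun_pair. Qed.

Let UV : {RV P >-> (T1 * T2)%type} :=
  HB.pack (fun w => (U w, V w)) (isMeasurableFun.Build _ _ _ _ _ mUV).

Let law_pair (A : set (T1 * T2)) : measurable A ->
  (mu \x distribution P V)%E A = distribution P UV A.
Proof.
move: A; apply: product_measure_unique => A B mA mB.
rewrite -[X in (X * _)%E]U_law// /distribution /pushforward/= -UV_indep//.
- by exists A => //; rewrite setTI.
- by exists B => //; rewrite setTI.
Qed.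

Let ge0_integral_pair (g : T1 * T2 -> \bar R) : measurable_fun [set: T1 * T2] g ->
  (forall z, 0 <= g z)%E ->
  (\int[P]_w g (U w, V w) = \int[mu \x distribution P V]_z g z)%E.
Proof.
move=> mg g0; rewrite (eq_measure_integral (distribution P UV)); last first.
  by move=> A mA _; exact: law_pair.
by rewrite ge0_integral_distribution.
Qed.

(** The right-hand side depends on [U] only through its law [mu]; this lets integrability pass from
    one copy of [Z] to another. *)
Lemma integrable_independent_pair (Phi : T1 * T2 -> R) :
  measurable_fun [set: T1 * T2] Phi ->
  P.-integrable setT (EFin \o (fun w => Phi (U w, V w))) <->
  (mu \x distribution P V)%E.-integrable setT (EFin \o Phi).
Proof.
move=> mPhi; have mPhi' : measurable_fun [set: T1 * T2] (abse \o (EFin \o Phi)).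
  by apply: measurableT_comp => //; apply/measurable_EFinP.
have e := ge0_integral_pair _ mPhi' (fun z => abse_ge0 _).
split=> /integrableP[_ lty]; apply/integrableP; split.
- exact/measurable_EFinP.
- by rewrite -e.
- by apply/measurable_EFinP; exact: measurableT_comp.
- by rewrite /= in e; rewrite e.
Qed.

Lemma integral_independent_pair (Phi : T1 * T2 -> R) :
  measurable_fun [set: T1 * T2] Phi ->
  P.-integrable setT (EFin \o (fun w => Phi (U w, V w))) ->
  (\int[P]_w (Phi (U w, V w))%:E =
   \int[mu \x distribution P V]_z (Phi z)%:E)%E.
Proof.
move=> mPhi iPhi; rewrite (eq_measure_integral (distribution P UV)); last first.
  by move=> A mA _; exact: law_pair.
by rewrite integral_distribution//; exact/measurable_EFinP.
Qed.

(** * Averaging over [U] with [V] fixed *)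

Section conditioning.
Variables (a : T2 -> R) (h : T1 * T2 -> R).
Hypotheses (ma : measurable_fun setT a) (mh : measurable_fun [set: T1 * T2] h).
Hypothesis ih : P.-integrable setT (EFin \o (fun w => h (U w, V w))).

Let m v := \int[mu]_u h (u, v).

Lemma measurable_fun_section_mean : measurable_fun setT m.
Proof.
have /measurable_fubini_G := (integrable_independent_pair _ mh).1 ih.
by move=> mG; apply: measurableT_comp mG.
Qed.

Lemma ae_section_integrable :
  {ae P, forall w, mu.-integrable setT (fun u => (h (u, V w))%:E)}.
Proof.
have /ae_integrable2 [N [mN N0 NP]] := (integrable_independent_pair _ mh).1 ih.
exists (V @^-1` N); split => //; last first.
  by move=> w nw; apply: NP.
by rewrite -[X in measurable X]setTI; exact: (measurable_funP V).
Qed.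

Hypothesis iah : P.-integrable setT (EFin \o (fun w => a (V w) * h (U w, V w))).

Let mah : measurable_fun [set: T1 * T2] (fun z : T1 * T2 => a z.2 * h z).
Proof. by apply: measurable_funM => //; exact: measurableT_comp. Qed.

(** The factor [a v] comes out of the inner integral wherever the section of [h] is integrable,
    hence outside a null set of the law of [V]. *)
Let fubini_ae : ae_eq (distribution P V) setT
  (fubini_G mu (EFin \o (fun z : T1 * T2 => a z.2 * h z)))
  (EFin \o (fun v => a v * m v)).
Proof.
have := ae_integrable2 ((integrable_independent_pair _ mh).1 ih).
apply: filterS => v iv _ /=.
rewrite /fubini_G/=; under eq_integral do rewrite EFinM.
rewrite integralZl// EFinM; congr (_ * _)%E.
by rewrite /m /Rintegral fineK//; exact: integrable_fin_num iv.
Qed.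

Let iG := (integrable_independent_pair _ mah).1 iah.

Let mam : measurable_fun setT (EFin \o (fun v => a v * m v)).
Proof.
apply/measurable_EFinP; apply: measurable_funM => //.
exact: measurable_fun_section_mean.
Qed.

Let iam : (distribution P V).-integrable setT (EFin \o (fun v => a v * m v)).
Proof.
have := iG; set f := EFin \o _ => if_.
have mf : measurable_fun [set: T1 * T2] f by exact: measurable_int if_.
have mG : measurable_fun setT (fubini_G mu f).
  exact: (measurable_fubini_G if_).
(* The absolute value of the inner integral is at most the inner integral of [|f|], whose own
   integral is finite by Tonelli. *)
have iGf : (distribution P V).-integrable setT (fubini_G mu f).
  apply/integrableP; split => //.
  apply: le_lt_trans ((integrable21ltyP _ _ mf).1 if_).
  apply: ge0_le_integral => //; first exact: measurableT_comp.
    apply: (measurable_fun_fubini_tonelli_G (abse \o f)) => //=.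
    exact: measurableT_comp.
  move=> v _; apply: le_abse_integral => //.
  exact: measurableT_comp.
move/integrableP : iGf => [_ lty].
apply/integrableP; split => //; 
rewrite -(ge0_ae_eq_integral _ _ _ _ _ (ae_eq_abse fubini_ae))//;
  by [exact: measurableT_comp|move=> *; exact: abse_ge0].
Qed.

Lemma integrable_section_mean :
  P.-integrable setT (EFin \o (fun w => a (V w) * m (V w))).
Proof.
have /integrableP[_ lty] := iam.
apply/integrableP; split.
  by apply: (measurableT_comp mam); exact: measurable_funP.
by rewrite ge0_integral_distribution// in lty; exact: measurableT_comp.
Qed.

(** This is E[h(U, V) | V] = m(V) tested against [a(V)], where [a] may be unbounded: [ih] makes
    almost every section integrable, and [iah] allows Fubini for the product. *)
Lemma expectation_section_mean :
  \int[P]_w (a (V w) * h (U w, V w)) = \int[P]_w (a (V w) * m (V w)).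
Proof.
rewrite /Rintegral; congr fine.
rewrite (integral_independent_pair _ mah)// -(integral21_prod_meas1 iG).
rewrite (ae_eq_integral _ _ _ _ _ fubini_ae)//; last exact: measurable_fubini_G iG.
by rewrite integral_distribution//; exact: integrable_section_mean.
Qed.

End conditioning.
End independent_pair.

(** * Independence of the next inner copy from the past *)

Section nested_independence.
Context {d d1 d2 : measure_display} {T : measurableType d}
  {T1 : measurableType d1} {T2 : measurableType d2} {R : realType}
  {P : probability T R} {Zs : nat -> {RV P >-> T1}} {Y : {RV P >-> T2}}.
Hypothesis Zs_indep : mutually_independent_RVs Zs.
Hypothesis ZsY_indep : sequence_independent_of Zs Y.

Let cyl K (B : nat -> set T1) :=
  \bigcap_(k in [set` [fset k in iota 0 K]%fset]) (Zs k @^-1` B k).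

(* The pi-system generating sigma(Z_0, ..., Z_(K-1), Y). *)
Definition past K : set (set T) :=
  [set E | exists2 B : nat -> set T1, (forall k, measurable (B k)) &
    exists2 D, measurable D & E = cyl K B `&` Y @^-1` D].

Let mZ k B : measurable B -> measurable (Zs k @^-1` B).
Proof.
by move=> mB; rewrite -[X in measurable X]setTI; exact: (measurable_funP (Zs k)).
Qed.

Let mY B : measurable B -> measurable (Y @^-1` B).
Proof.
by move=> mB; rewrite -[X in measurable X]setTI; exact: (measurable_funP Y).
Qed.

Let cylP K B w : cyl K B w <-> forall k, (k < K)%N -> B k (Zs k w).
Proof.
split=> [cw k kK|cw k /=]; last by rewrite inE/= mem_iota add0n => /cw.
by apply: (cw k); rewrite /= inE/= mem_iota.
Qed.

Let mcyl K B : (forall k, measurable (B k)) -> measurable (cyl K B).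
Proof. by move=> mB; apply: fin_bigcap_measurable => // k _; exact: mZ. Qed.

Let cylS K A B : measurable A -> (forall k, measurable (B k)) ->
  Zs K @^-1` A `&` cyl K B = cyl K.+1 (fun k => if k == K then A else B k).
Proof.
move=> mA mB; apply/seteqP; split => w.
  move=> [Aw /cylP cw]; apply/cylP => k; case: eqVneq => [->//|kK].
  by rewrite ltnS leq_eqVlt (negbTE kK)/= => /cw.
move=> /cylP cw; split; first by have := cw K (ltnSn K); rewrite eqxx.
apply/cylP => k kK; have := cw k (ltnW kK).
by case: eqVneq kK => [->|//]; rewrite ltnn.
Qed.

Let P_cylS K A B : measurable A -> (forall k, measurable (B k)) ->
  (P (Zs K @^-1` A `&` cyl K B) = P (Zs K @^-1` A) * P (cyl K B))%E.
Proof.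
move=> mA mB; rewrite cylS// /cyl.
have e : [fset k in iota 0 K.+1]%fset = (K |` [fset k in iota 0 K])%fset.
  apply/fsetP => k; rewrite in_fset1U !in_fset !mem_iota !add0n.
  by rewrite !leq0n ltnS leq_eqVlt.
rewrite Zs_indep; last by move=> k; case: ifP.
rewrite e big_fsetU1/=; last by rewrite inE/= mem_iota add0n ltnn.
rewrite eqxx Zs_indep//; congr (_ * _)%E.
apply: eq_big_seq => k; rewrite inE/= mem_iota add0n => kK.
by case: eqVneq kK => [->|//]; rewrite ltnn.
Qed.

Let cyl_sigma K B : (forall k, measurable (B k)) ->
  <<s \bigcup_k g_sigma_algebra_preimage (Zs k) >> (cyl K B).
Proof.
move=> mB; pose G := \bigcup_k g_sigma_algebra_preimage (Zs k).
apply: (@fin_bigcap_measurable _ (g_sigma_algebraType G)) => // k _.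
by apply: sub_sigma_algebra; exists k => //; exists (B k) => //; rewrite setTI.
Qed.

(** The cylinders of lengths [K.+1] and [K] both lie in the sigma-algebra of the sequence, so [Y]
    splits off on both sides; mutual independence of the copies then splits off [Zs K]. *)
Let P_past K A B D : measurable A -> (forall k, measurable (B k)) ->
  measurable D -> (P (Zs K @^-1` A `&` (cyl K B `&` Y @^-1` D)) =
    P (Zs K @^-1` A) * P (cyl K B `&` Y @^-1` D))%E.
Proof.
move=> mA mB mD; have YD : g_sigma_algebra_preimage Y (Y @^-1` D).
  by exists D => //; rewrite setTI.
rewrite setIA ZsY_indep//; last first.
  by rewrite cylS//; apply: cyl_sigma => k; case: ifP.
rewrite (ZsY_indep _ _ (cyl_sigma K B mB) YD).
by rewrite P_cylS// muleA.
Qed.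

(** For fixed [A], the finite measures that send [E] to [P(Z_K in A, E)] and to [P(Z_K in A) P(E)]
    agree on the pi-system [past K], hence on the sigma-algebra it generates, which contains the
    events of [V]. *)
Lemma independent_past K d3 (T3 : measurableType d3) (V : {RV P >-> T3}) :
  measurable_fun [set: g_sigma_algebraType (past K)] V ->
  independent_RVs (Zs K) V.
Proof.
move=> mV _ _ [A mA <-] [B mB <-]; rewrite !setTI.
have PAfin : P (Zs K @^-1` A) \is a fin_num by rewrite fin_num_measure//; exact: mZ.
have PA0 : 0 <= fine (P (Zs K @^-1` A)) by exact: fine_ge0.
pose m1 := mrestr P (mZ K _ mA).
pose m2 := mscale (NngNum PA0) P.
have pT : past K setT.
  exists (fun=> setT) => //; exists setT => //.
  by rewrite preimage_setT setIT /cyl bigcapT.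
have m2E X : m2 X = (P (Zs K @^-1` A) * P X)%E by rewrite -[in RHS](fineK PAfin).
rewrite setIC -m2E -[LHS]/(m1 _).
apply: (@g_sigma_algebra_measure_unique _ R T (past K) _ (fun=> setT)).
- move=> _ [C mC [D mD ->]]; apply: measurableI; first exact: mcyl.
  exact: mY.
- by [].
- by rewrite bigcup_const.
- move=> _ _ [C mC [D mD ->]] [C' mC' [D' mD' ->]].
  exists (fun k => C k `&` C' k); first by move=> k; exact: measurableI.
  exists (D `&` D'); first exact: measurableI.
  by rewrite preimage_setI setIACA /cyl -bigcapI.
- by move=> _ [C mC [D mD ->]]; rewrite [RHS]m2E -P_past// /m1/= /mrestr setIC.
- by move=> _; rewrite /m1 /= /mrestr setTI -ge0_fin_numE.
- by rewrite -[X in _ X]setTI; exact: mV.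
Qed.

Lemma measurable_past_Zs K j : (j < K)%N ->
  measurable_fun [set: g_sigma_algebraType (past K)] (Zs j).
Proof.
move=> jK _ B mB; apply: sub_sigma_algebra.
exists (fun k => if k == j then B else setT); first by move=> k; case: ifP.
exists setT => //; rewrite preimage_setT setIT setTI.
apply/seteqP; split=> w.
  by move=> Bw; apply/cylP => k kK; case: eqVneq => [->|].
by move/cylP => /(_ _ jK); rewrite eqxx.
Qed.

Lemma measurable_past_Y K : measurable_fun [set: g_sigma_algebraType (past K)] Y.
Proof.
move=> _ B mB; apply: sub_sigma_algebra; exists (fun=> setT) => //.
exists B => //; congr (_ `&` _).
by apply/seteqP; split=> w _; [apply/cylP => k _|].
Qed.

Lemma independent_Zs_Y K : independent_RVs (Zs K) Y.
Proof. by apply: independent_past; exact: measurable_past_Y. Qed.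

Definition partial_sum (H : T1 * T2 -> R) K w := \sum_(j < K) H (Zs j w, Y w).

Section partial_sums.
Context {H : T1 * T2 -> R} (mH : measurable_fun [set: T1 * T2] H).

Lemma measurable_partial_sum K :
  measurable_fun [set: T] (fun w => partial_sum H K w).
Proof.
apply: measurable_sum => j; apply: measurableT_comp => //.
exact: measurable_fun_pair.
Qed.

Let mpair K : measurable_fun [set: T] (fun w => (partial_sum H K w, Y w)).
Proof. by apply: measurable_fun_pair => //; exact: measurable_partial_sum. Qed.

(** Sum and [Y] are joined in one random variable because the weights [G(Y) S_K^(m - i)] depend on
    both, so that conditioning is on the pair. *)
Definition partial_sum_pair K : {RV P >-> (R * T2)%type} :=
  HB.pack (fun w => (partial_sum H K w, Y w))
    (isMeasurableFun.Build _ _ _ _ _ (mpair K)).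

Lemma independent_partial_sum K : independent_RVs (Zs K) (partial_sum_pair K).
Proof.
apply: independent_past; apply: measurable_fun_pair.
  apply: measurable_sum => j; apply: measurableT_comp => //.
  apply: measurable_fun_pair; last exact: measurable_past_Y.
  exact: measurable_past_Zs.
exact: measurable_past_Y.
Qed.

End partial_sums.
End nested_independence.

Arguments partial_sum {d d1 d2 T T1 T2 R P} Zs Y H K w.

(** * Moments of conditionally centered sums *)

(** A crude form of Young's inequality: the smaller of the two absolute values is replaced by the
    larger. *)
Lemma normr_exprM_le {R : realDomainType} (x y : R) p q :
  `|x| ^+ p * `|y| ^+ q <= `|x| ^+ (p + q) + `|y| ^+ (p + q).
Proof.
rewrite !exprD; have [xy|/ltW yx] := leP `|x| `|y|.
  rewrite -[leLHS]add0r lerD ?mulr_ge0 ?exprn_ge0//.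
  by rewrite ler_wpM2r ?exprn_ge0// lerXn2r ?nnegrE.
rewrite -[leLHS]addr0 lerD ?mulr_ge0 ?exprn_ge0//.
by rewrite ler_wpM2l ?exprn_ge0// lerXn2r ?nnegrE.
Qed.

Lemma normr_exprD_le {R : realDomainType} (x y : R) n :
  `|x + y| ^+ n <= 2 ^+ n * (`|x| ^+ n + `|y| ^+ n).
Proof.
have le2 (a b : R) : `|a| <= `|b| -> `|a + b| ^+ n <= 2 ^+ n * (`|a| ^+ n + `|b| ^+ n).
  move=> ab; apply: (@le_trans _ _ ((2 * `|b|) ^+ n)).
    rewrite lerXn2r ?nnegrE ?mulr_ge0// (le_trans (ler_normD _ _))//.
    by rewrite mulr_natl mulr2n lerD2r.
  by rewrite exprMn ler_wpM2l ?exprn_ge0// lerDr exprn_ge0.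
have [|/ltW] := leP `|x| `|y|; first exact: le2.
by rewrite addrC (addrC (`|x| ^+ n)); exact: le2.
Qed.

Section real_integrable.
Context {d : measure_display} {T : measurableType d} {R : realType}
  {mu : {measure set T -> \bar R}}.
Implicit Types X W : T -> R.

Lemma integrable_le {X W} : mu.-integrable setT (EFin \o W) ->
  measurable_fun [set: T] X -> (forall w, `|X w| <= W w) ->
  mu.-integrable setT (EFin \o X).
Proof.
move=> iW mX XW; apply: le_integrable iW => //; first exact/measurable_EFinP.
by move=> w _; rewrite lee_fin (le_trans (XW w))// ler_norm.
Qed.

Lemma integrable_addr {X W} : mu.-integrable setT (EFin \o X) ->
  mu.-integrable setT (EFin \o W) ->
  mu.-integrable setT (EFin \o (fun w => X w + W w)).
Proof. by move=> iX iW; have := integrableD measurableT iX iW. Qed.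

Lemma integrable_mulrl (c : R) {X} : mu.-integrable setT (EFin \o X) ->
  mu.-integrable setT (EFin \o (fun w => c * X w)).
Proof. by move=> iX; have := integrableZl measurableT c iX. Qed.

Lemma integrable_sumr I (s : seq I) (Q : pred I) (X : I -> T -> R) :
  (forall i, Q i -> mu.-integrable setT (EFin \o X i)) ->
  mu.-integrable setT (EFin \o (fun w => \sum_(i <- s | Q i) X i w)).
Proof.
move=> iX; rewrite (_ : _ \o _ = fun w => (\sum_(i <- s | Q i) (X i w)%:E)%E).
  exact: integrable_sum.
by apply/funext => w; rewrite /= sumEFin.
Qed.

Lemma Rintegral_sum I (s : seq I) (X : I -> T -> R) :
  (forall i, mu.-integrable setT (EFin \o X i)) ->
  \int[mu]_w (\sum_(i <- s) X i w) = \sum_(i <- s) \int[mu]_w X i w.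
Proof.
move=> iX; elim: s => [|i s IH].
  rewrite big_nil; under eq_Rintegral do rewrite big_nil.
  by rewrite /Rintegral integral0.
under eq_Rintegral do rewrite big_cons.
by rewrite big_cons RintegralD ?IH//; exact: integrable_sumr.
Qed.

End real_integrable.

Section moments.
Context {d d1 d2 : measure_display} {T : measurableType d}
  {T1 : measurableType d1} {T2 : measurableType d2} {R : realType}
  {P : probability T R} {Zs : nat -> {RV P >-> T1}} {Y : {RV P >-> T2}}
  {mu : probability T1 R}.
Hypothesis Zs_indep : mutually_independent_RVs Zs.
Hypothesis ZsY_indep : sequence_independent_of Zs Y.
Hypothesis Zs_law : forall k B, measurable B -> P (Zs k @^-1` B) = mu B.

Let ZsYk k := independent_Zs_Y Zs_indep ZsY_indep k.

Lemma integrable_copies (Phi : T1 * T2 -> R) j k :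
  measurable_fun [set: T1 * T2] Phi ->
  P.-integrable setT (EFin \o (fun w => Phi (Zs j w, Y w))) ->
  P.-integrable setT (EFin \o (fun w => Phi (Zs k w, Y w))).
Proof.
move=> mPhi /(integrable_independent_pair (ZsYk j) (Zs_law j) _ mPhi).
by move/(integrable_independent_pair (ZsYk k) (Zs_law k) _ mPhi).
Qed.

Context {H : T1 * T2 -> R} (mH : measurable_fun [set: T1 * T2] H) (n : nat).
Hypothesis iHn : P.-integrable setT (EFin \o (fun w => `|H (Zs 0%N w, Y w)| ^+ n)).

Local Notation S := (partial_sum Zs Y H).

(* The total degree m is what the recursion on moments preserves: it replaces
   (m, G) by (m - i, G * section_moment i). *)
Definition moment_weight (m : nat) (G : T2 -> R) :=
  measurable_fun [set: T2] G /\
  P.-integrable setT (EFin \o (fun w => G (Y w) * H (Zs 0%N w, Y w) ^+ m)).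

Definition section_moment i y := \int[mu]_z (H (z, y) ^+ i).

Let mHX i : measurable_fun [set: T1 * T2] (fun z => H z ^+ i).
Proof. exact: measurable_funX. Qed.

Let mHk k : measurable_fun [set: T] (fun w => H (Zs k w, Y w)).
Proof. by apply: measurableT_comp => //; exact: measurable_fun_pair. Qed.

Let mGY (G : T2 -> R) : measurable_fun [set: T2] G -> measurable_fun [set: T] (fun w => G (Y w)).
Proof. by move=> mG; apply: measurableT_comp. Qed.

Lemma integrable_sectionX k i : (i <= n)%N ->
  P.-integrable setT (EFin \o (fun w => H (Zs k w, Y w) ^+ i)).
Proof.
move=> ilen; apply: (integrable_copies (fun z => H z ^+ i) 0) => //.
(* For [i <= n], comparing [|x|] with 1 gives [|x|^i <= |x|^n + 1]. *)
apply: (integrable_le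
  (integrable_addr iHn (finite_measure_integrable_cst P 1 measurableT))).
  exact: measurable_funX.
move=> w; rewrite normrX; set x := `|_|.
have x0 : 0 <= x by exact: normr_ge0.
have [x1|/ltW x1] := leP x 1.
  apply: (@le_trans _ _ 1); first by rewrite exprn_ile1.
  by rewrite /= lerDr exprn_ge0.
by rewrite (le_trans (ler_weXn2l x1 ilen))//= lerDl.
Qed.

Let iGHk m G k : moment_weight m G ->
  P.-integrable setT (EFin \o (fun w => G (Y w) * H (Zs k w, Y w) ^+ m)).
Proof.
move=> [mG iG]; apply: (integrable_copies (fun z => G z.2 * H z ^+ m) 0 k) => //.
by apply: measurable_funM => //; exact: measurableT_comp.
Qed.

Let mS K : measurable_fun [set: T] (S K).
Proof. exact: (measurable_partial_sum mH K). Qed.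

Lemma integrable_partial_sumX m G K : moment_weight m G ->
  P.-integrable setT (EFin \o (fun w => `|G (Y w)| * `|S K w| ^+ m)).
Proof.
move=> wG; have [mG iG0] := wG.
have iGn k : P.-integrable setT
    (EFin \o (fun w => `|G (Y w)| * `|H (Zs k w, Y w)| ^+ m)).
  apply: (eq_integrable measurableT _ _ _ (integrable_norm (iGHk _ _ k wG))).
  by move=> w _; rewrite /= normrM normrX.
elim: K => [|K IH].
  (* Domination by a term in [H] instead of by 0 also covers [m = 0], where the power of the empty
     sum is 1. *)
  apply: (integrable_le (iGn 0%N)).
    apply: measurable_funM; first exact/measurableT_comp/mGY.
    by apply/measurable_funX/measurableT_comp.
  move=> w; rewrite /partial_sum big_ord0 normr0 ger0_norm; last first.
    by rewrite mulr_ge0 ?exprn_ge0.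
  by rewrite ler_wpM2l// lerXn2r ?nnegrE.
apply: (integrable_le
  (integrable_mulrl (2 ^+ m) (integrable_addr IH (iGn K)))).
  apply: measurable_funM; first exact/measurableT_comp/mGY.
  by apply/measurable_funX/measurableT_comp.
move=> w; rewrite ger0_norm ?mulr_ge0 ?exprn_ge0// -mulrDr mulrCA.
by rewrite ler_wpM2l// /partial_sum big_ord_recr/= normr_exprD_le.
Qed.

Let iGSH m G K i : moment_weight m G -> (i <= m)%N ->
  P.-integrable setT (EFin \o
    (fun w => G (Y w) * S K w ^+ (m - i) * H (Zs K w, Y w) ^+ i)).
Proof.
move=> wG im; have [mG _] := wG.
have iG := integrable_norm (iGHk _ _ K wG).
apply: (integrable_le
  (integrable_addr (integrable_partial_sumX _ _ K wG) iG)).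
  apply: measurable_funM; last exact: measurable_funX.
  by apply: measurable_funM; [exact: mGY|exact: measurable_funX].
move=> w; rewrite /= !normrM !normrX -mulrDr -mulrA ler_wpM2l//.
by have := normr_exprM_le (S K w) (H (Zs K w, Y w)) (m - i) i; rewrite subnK.
Qed.

(** * One step of the recursion on moments *)

Section one_step.
Context {m : nat} {G : T2 -> R} (wG : moment_weight m G) (m_le_n : (m <= n)%N).

Let a i (sy : R * T2) := G sy.2 * sy.1 ^+ (m - i).
Let h i (z : T1 * (R * T2)) := H (z.1, z.2.2) ^+ i.

Let ma i : measurable_fun [set: R * T2] (a i).
Proof.
have [mG _] := wG.
by apply: measurable_funM; [exact: measurableT_comp|exact: measurable_funX].
Qed.

Let mh i : measurable_fun [set: T1 * (R * T2)] (h i).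
Proof.
apply: measurable_funX; apply: measurableT_comp => //.
by apply: measurable_fun_pair => //; exact: measurableT_comp.
Qed.

Let indepS K := independent_partial_sum Zs_indep ZsY_indep mH K.

Lemma integrable_step i K : (i <= m)%N -> P.-integrable setT (EFin \o
  (fun w => G (Y w) * S K w ^+ (m - i) * section_moment i (Y w))).
Proof.
move=> im; apply: (integrable_section_mean (indepS K) (Zs_law K) (a i) (h i)) => //.
  exact: integrable_sectionX (leq_trans im m_le_n).
exact: iGSH.
Qed.

(** Conditionally on [(S_K, Y)] the copy [Zs K] still has law [mu], so the power of [H(Zs K, Y)] can
    be replaced by its mean under [mu]. *)
Lemma expectation_step i K : (i <= m)%N ->
  \int[P]_w (G (Y w) * S K w ^+ (m - i) * H (Zs K w, Y w) ^+ i) =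
  \int[P]_w (G (Y w) * S K w ^+ (m - i) * section_moment i (Y w)).
Proof.
move=> im; apply: (expectation_section_mean (indepS K) (Zs_law K) (a i) (h i)) => //.
  exact: integrable_sectionX (leq_trans im m_le_n).
exact: iGSH.
Qed.

(* No moment inequality is needed: the step from S_1 = H(Z_0, Y) to S_2 already
   contains the required integrability. *)
Lemma moment_weightM i : (i <= m)%N ->
  moment_weight (m - i) (fun y => G y * section_moment i y).
Proof.
move=> im; split.
  have [mG _] := wG; apply: measurable_funM => //.
  apply: (measurable_fun_section_mean (ZsYk 0%N) (Zs_law 0%N) (fun z => H z ^+ i)) => //.
  exact: integrable_sectionX (leq_trans im m_le_n).
have := integrable_step i 1 im; rewrite /partial_sum.
by under eq_fun do rewrite /= big_ord1 mulrAC.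
Qed.

Lemma expectation_partial_sumS K :
  \int[P]_w (G (Y w) * S K.+1 w ^+ m) = \sum_(i < m.+1) 'C(m, i)%:R *
    \int[P]_w (G (Y w) * section_moment i (Y w) * S K w ^+ (m - i)).
Proof.
transitivity (\int[P]_w \sum_(i < m.+1) ('C(m, i)%:R *
    (G (Y w) * S K w ^+ (m - i) * H (Zs K w, Y w) ^+ i))).
  apply: eq_Rintegral => w _; rewrite {1}/partial_sum big_ord_recr/= exprDn.
  rewrite mulr_sumr; apply: eq_bigr => i _.
  by rewrite -mulr_natl /partial_sum; ring.
rewrite Rintegral_sum => [|i].
  apply: eq_bigr => i _; have im : (i <= m)%N by rewrite -ltnS.
  rewrite RintegralZl//; last exact: iGSH.
  rewrite expectation_step//; congr (_ * _).
  by apply: eq_Rintegral => w _; rewrite mulrAC.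
by apply: integrable_mulrl; apply: iGSH => //; rewrite -ltnS.
Qed.

End one_step.

(* In place of Jensen's inequality, the n factors H(Z_0, Y) are replaced one at
   a time by their conditional mean. *)
Lemma moment_weight_meanX i : (i <= n)%N ->
  moment_weight (n - i) (fun y => section_moment 1 y ^+ i).
Proof.
elim: i => [_|i IH ilt].
  split; first exact: measurable_cst.
  rewrite subn0; under eq_fun do rewrite /= expr0 mul1r.
  exact: integrable_sectionX.
rewrite subnS -subn1; under eq_fun do rewrite exprSr.
apply: (moment_weightM (IH (ltnW ilt)) (leq_subr _ _) 1).
by rewrite subn_gt0.
Qed.

(** The case [i = n], in which every factor has been averaged. It precedes the centering hypothesis
    because it is applied with the uncentered [F] as [H], to control the conditional mean in order
    [n]. *)
Lemma integrable_meanX :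
  P.-integrable setT (EFin \o (fun w => section_moment 1 (Y w) ^+ n)).
Proof.
have [_] := moment_weight_meanX n (leqnn n).
by rewrite subnn; under eq_fun do rewrite /= expr0 mulr1.
Qed.

Hypothesis section_mean0 : {ae P, forall w, section_moment 1 (Y w) = 0}.

Lemma section_moment0 y : section_moment 0 y = 1.
Proof.
rewrite /section_moment; under eq_Rintegral do rewrite expr0.
by rewrite Rintegral_cst//= (@probability_setT _ _ _ mu) mulr1.
Qed.

Lemma newton_moment m G : (m <= n)%N -> moment_weight m G ->
  newton (m./2).+1 (fun K => \int[P]_w (G (Y w) * S K w ^+ m)).
Proof.
elim/ltn_ind: m G => m IH G mn wG.
case: m => [|m] in IH mn wG *.
  rewrite (_ : (fun K => _) = fun=> \int[P]_w G (Y w)); first exact: newton_cst.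
  by apply/funext => K; apply: eq_Rintegral => w _; rewrite expr0 mulr1.
apply: newton_antidiff.
  under eq_Rintegral do rewrite /partial_sum big_ord0 expr0n mulr0.
  by rewrite Rintegral_cst// mul0r.
(* In the increment, the binomial term of index 0 cancels against the moment at [K] and that of
   index 1 vanishes by centering. The others lower the exponent by at least two, hence the degree
   bound in [K] by at least one, which discrete integration restores. *)
rewrite (_ : (fun K => _) = fun K => \sum_(i < m) 'C(m.+1, i.+2)%:R *
    \int[P]_w (G (Y w) * section_moment i.+2 (Y w) * S K w ^+ (m.+1 - i.+2))).
  apply: newton_sum => i _; apply: newtonZ.
  apply: (@newton_le _ ((m.+1 - i.+2)./2).+1).
    have := ltn_ord i; lia.
  apply: (IH (m.+1 - i.+2)%N _ (fun y => G y * section_moment i.+2 y)); [lia|lia|].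
  by apply: (moment_weightM wG mn i.+2); have := ltn_ord i; lia.
apply/funext => K; rewrite (expectation_partial_sumS wG mn) !big_ord_recl/=.
rewrite bin0 mul1r subn0; under eq_Rintegral do rewrite section_moment0 mulr1.
rewrite [X in _ + (_ * X + _)](_ : _ = 0); last first.
  have [mGm _] := moment_weightM wG mn 1 isT.
  rewrite /Rintegral (ae_eq_integral (cst 0%E))//=; first by rewrite integral0.
    apply/measurable_EFinP; apply: measurable_funM; last exact: measurable_funX.
    exact: (mGY _ mGm).
  by apply: filterS section_mean0 => w /= -> _; rewrite mulr0 mul0r.
by rewrite mulr0 add0r addrAC subrr add0r.
Qed.

End moments.

Arguments section_moment {d1 d2 T1 T2 R} mu H i y.
Arguments moment_weight {d d1 d2 T T1 T2 R P} Zs Y H m G.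

(** * Conditional expectation as a section mean *)

Section conditional_expectation.
Context {d d1 d2 : measure_display} {T : measurableType d}
  {T1 : measurableType d1} {T2 : measurableType d2} {R : realType}
  {P : probability T R} {U : {RV P >-> T1}} {V : {RV P >-> T2}}
  {mu : probability T1 R}.
Hypothesis UV_indep : independent_RVs U V.
Hypothesis U_law : forall B, measurable B -> P (U @^-1` B) = mu B.
Context {h : T1 * T2 -> R} (mh : measurable_fun [set: T1 * T2] h)
  {X : {RV P >-> R}} (X_def : forall w, X w = h (U w, V w))
  {C : T -> R} (C_cond : is_cond_expectation X V C).
Hypothesis iX : P.-integrable setT (EFin \o X).

Let m v := \int[mu]_u h (u, v).

Let ih : P.-integrable setT (EFin \o (fun w => h (U w, V w))).
Proof. by apply: eq_integrable iX => // w _ /=; rewrite X_def. Qed.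

Let mm : measurable_fun setT m.
Proof. exact: (measurable_fun_section_mean UV_indep U_law h mh ih). Qed.

Let im : P.-integrable setT (EFin \o (fun w => m (V w))).
Proof.
have := integrable_section_mean UV_indep U_law (cst 1) h (measurable_cst _) mh ih.
under eq_fun do rewrite /= mul1r; move=> /(_ ih).
by under eq_fun do rewrite /= mul1r.
Qed.

Let iC : P.-integrable setT (EFin \o C).
Proof. by have [/Lfun1_integrable] := C_cond. Qed.

Let mV B : measurable B -> measurable (V @^-1` B).
Proof.
by move=> mB; rewrite -[X in measurable X]setTI; exact: (measurable_funP V).
Qed.

Let integral_set_indic (f : T -> R) B :
  (\int[P]_(w in V @^-1` B) (f w)%:E = \int[P]_w (\1_B (V w) * f w)%:E)%E.
Proof.
rewrite integral_mkcond; apply: eq_integral => w _.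
rewrite patchE indicE; have [Bw|Bw] := boolP (V w \in B).
  by rewrite mem_set ?mul1r//; rewrite inE in Bw.
by rewrite mul0r ifF//; apply/negbTE; move: Bw; rewrite !notin_setE.
Qed.

(** On the event that [V] lies in [B], both functions have the same integral as [X]: [C] by
    definition, [m(V)] by averaging out [U] with the weight [\1_B]. *)
Let int0 B : measurable B ->
  (\int[P]_(w in V @^-1` B) (C w - m (V w))%:E = 0)%E.
Proof.
move=> mB; under eq_integral do rewrite EFinB.
have iCB := integrableS measurableT (mV _ mB) (@subsetT _ _) iC.
have imB := integrableS measurableT (mV _ mB) (@subsetT _ _) im.
rewrite (integralB (mV _ mB) iCB imB).
have [_ _ ->] := C_cond; last by exists B => //; rewrite setTI.
have m1 : measurable_fun [set: T2] (\1_B : T2 -> R) by exact: measurable_indic.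
have i1h : P.-integrable setT
    (EFin \o (fun w => \1_B (V w) * h (U w, V w))).
  apply: (integrable_le (integrable_norm ih)).
    apply: measurable_funM; first exact: measurableT_comp.
    exact/measurable_EFinP/(measurable_int _ ih).
  by move=> w; rewrite normrM indicE ler_piMl//; case: (_ \in _); rewrite ?normr1 ?normr0.
have e := expectation_section_mean UV_indep U_law (\1_B) h m1 mh ih i1h.
have i1m := integrable_section_mean UV_indep U_law (\1_B) h m1 mh ih i1h.
have {}e : (\int[P]_w (\1_B (V w) * h (U w, V w))%:E =
    \int[P]_w (\1_B (V w) * m (V w))%:E)%E.
  rewrite -[LHS]fineK ?integrable_fin_num// -[RHS]fineK ?integrable_fin_num//.
  by congr EFin.
rewrite !integral_set_indic; under eq_integral do rewrite X_def.
by rewrite e subee// integrable_fin_num.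
Qed.

(** The difference [D] is measurable for the sigma-algebra of [V] and integrates to 0 over each of
    its events, in particular over those where [D] is positive or negative. *)
Lemma cond_expectation_section_mean : {ae P, forall w, C w = m (V w)}.
Proof.
pose D w := C w - m (V w).
have mD : measurable_fun [set: g_sigma_algebra_preimageType V] D.
  apply: measurable_funB; first by have [] := C_cond.
  apply: (measurableT_comp mm) => _ B mB; rewrite setTI.
  by exists B => //; rewrite setTI.
have mDT : measurable_fun [set: T] D.
  apply: measurable_funB; first exact/measurable_EFinP/(measurable_int _ iC).
  exact: measurableT_comp.
(* [b] selects the sign: [D > 0] for [false], [D < 0] for [true]. On that event [|D|] is [D] up to a
   fixed sign, so its integral is 0. *)
have D0 (b : bool) : {ae P, forall w, 0 < (-1) ^+ b * D w -> D w = 0}.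
  have [B mB eB] : g_sigma_algebra_preimage V [set w | 0 < (-1) ^+ b * D w].
    have mbD : measurable_fun [set: g_sigma_algebra_preimageType V]
        (fun w => (-1) ^+ b * D w) by apply: measurable_funM.
    have := mbD measurableT `]0, +oo[%classic (measurable_itv _).
    rewrite setTI; congr (g_sigma_algebra_preimage V _).
    by apply/seteqP; split=> w /=; rewrite in_itv/= andbT.
  rewrite setTI in eB.
  have DB (w : T) : (V @^-1` B) w -> `|D w| = (-1) ^+ b * D w.
    rewrite eB/= => Dpos; rewrite -[RHS]gtr0_norm// normrM normrX normrN1.
    by rewrite expr1n mul1r.
  have : ae_eq P (V @^-1` B) (EFin \o D) (cst 0%E).
    apply/ae_eq_integral_abs; [exact: mV| |].
      by apply/measurable_EFinP; exact: measurable_funTS.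
    have iDB : P.-integrable (V @^-1` B) (EFin \o D).
      apply: (integrableS measurableT (mV _ mB) (@subsetT _ _)).
      by have := integrableB measurableT iC im.
    transitivity (((-1) ^+ b)%:E * \int[P]_(w in V @^-1` B) (EFin \o D) w)%E.
      rewrite -integralZl//; last exact: mV.
      by apply: eq_integral => w; rewrite inE => /DB /= ->.
    by rewrite (int0 _ mB) mule0.
  rewrite eB; apply: filterS => w /= H Dpos; exact/EFin_inj/H.
apply: filterS2 (D0 false) (D0 true) => w D1 D2.
apply/eqP; rewrite -subr_eq0; apply/eqP; rewrite -/(D w).
have [Dneg|Dpos|//] := ltgtP (D w) 0.
  by apply: D2; rewrite expr1 mulN1r oppr_gt0.
by apply: D1; rewrite expr0 mul1r.
Qed.

End conditional_expectation.

(** * Expansions along inverse integers *)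

Lemma steps_itv {R : realType} (h : R) : steps h -> 0 < h <= 1.
Proof.
move=> [K K0 ->]; rewrite invr_gt0 ltr0n K0/=.
by rewrite invf_le1 ?ltr0n// ler1n.
Qed.

Lemma horner_le_sum {R : realDomainType} (q : {poly R}) (h : R) : 0 <= h <= 1 ->
  `|q.[h]| <= \sum_(i < size q) `|q`_i|.
Proof.
move=> /andP[h0 h1]; rewrite horner_coef (le_trans (ler_norm_sum _ _ _))//.
apply: ler_sum => i _; rewrite normrM ler_piMr// ger0_norm ?exprn_ge0//.
exact: exprn_ile1.
Qed.

(** The first [s] coefficients of [q] form the expansion; the rest of [q] and the error, both of
    order [h^(s + 1)], go into [h^s eta], so that [eta] is O(h). *)
Lemma inverse_integer_expansion {R : realType} (e : R -> R) (q : {poly R})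
    (M : R) (s : nat) : 0 <= M ->
  (forall h, steps h -> `|e h - h * q.[h]| <= M * h ^+ s.+1) ->
  exists (c : nat -> R) (eta : R -> R),
    (forall h, steps h -> e h = \sum_(1 <= k < s.+1) c k * h `^ (1 * k%:R)
       + h `^ (1 * s%:R) * eta h) /\
    (eta h @[h --> within (@steps R) (nbhs (0 : R))] --> (0 : R)).
Proof.
move=> M0 eM; pose Q := drop_poly s q.
pose eta h := (e h - h * (take_poly s q).[h]) / h ^+ s.
have etaE h : steps h -> h ^+ s * eta h = e h - h * (take_poly s q).[h].
  move=> /steps_itv/andP[h0 _].
  by rewrite /eta mulrC divfK// expf_neq0// gt_eqF.
(* The index is shifted by one because [q] comes with a factor [h]. *)
exists (fun k => q`_k.-1), eta; split=> [h sh|].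
  have /andP[h0 _] := steps_itv h sh.
  rewrite mul1r powR_mulrn ?(ltW h0)// etaE// big_add1/= big_mkord.
  rewrite [X in X + _](_ : _ = h * (take_poly s q).[h]); last first.
    rewrite /take_poly horner_poly mulr_sumr; apply: eq_bigr => k _.
    by rewrite mul1r powR_mulrn ?(ltW h0)// exprS mulrCA.
  by rewrite addrC subrK.
pose B := M + \sum_(i < size Q) `|Q`_i|.
have B0 : 0 <= B by rewrite addr_ge0// sumr_ge0.
have etaB h : steps h -> `|eta h| <= B * h.
  move=> sh; have /andP[h0 h1] := steps_itv h sh.
  have hs0 : 0 < h ^+ s by rewrite exprn_gt0.
  rewrite -(ler_pM2l hs0) -[X in X * `|_|]gtr0_norm// -normrM etaE//.
  have -> : e h - h * (take_poly s q).[h] =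
      (e h - h * q.[h]) + h * Q.[h] * h ^+ s.
    rewrite -[in h * q.[h]](poly_take_drop s q) hornerD hornerM hornerXn; ring.
  rewrite (le_trans (ler_normD _ _))// mulrCA -exprSr mulrDl lerD ?eM//.
  rewrite !normrM (gtr0_norm h0) (gtr0_norm hs0) exprSr.
  rewrite mulrAC [leRHS]mulrC [_ ^+ s * h]mulrC ler_wpM2l ?mulr_ge0 ?(ltW h0) ?(ltW hs0)//.
  by apply: horner_le_sum; rewrite (ltW h0).
apply/cvgrPdist_le => eps eps0; rewrite near_withinE.
(* [B + 1] in place of [B] keeps the radius positive when [B = 0]. *)
have B10 : 0 < B + 1 by rewrite ltr_wpDl.
have d0 : 0 < eps / (B + 1) by rewrite divr_gt0.
apply: filterS (@nbhs0_lt R R _ d0) => h; rewrite ltr_pdivlMr// => hd sh.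
rewrite sub0r normrN (le_trans (etaB h sh))//.
have /andP[h0 _] := steps_itv h sh.
rewrite gtr0_norm// in hd; rewrite (le_trans _ (ltW hd))// mulrC.
by rewrite ler_wpM2l ?(ltW h0)// lerDl.
Qed.

(** * Errors of the nested estimator *)

Section nested_monte_carlo.
Context {d d1 d2 : measure_display} {T : measurableType d}
  {T1 : measurableType d1} {T2 : measurableType d2} {R : realType}
  {P : probability T R} {Zs : nat -> {RV P >-> T1}} {Y : {RV P >-> T2}}
  {mu : probability T1 R}.
Hypothesis Zs_indep : mutually_independent_RVs Zs.
Hypothesis ZsY_indep : sequence_independent_of Zs Y.
Hypothesis Zs_law : forall k B, measurable B -> P (Zs k @^-1` B) = mu B.

Context {F : T1 * T2 -> R} (mF : measurable_fun [set: T1 * T2] F) {r : nat}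
  (r_gt0 : (0 < r)%N).
Local Notation n := (2 * r)%N.
Hypothesis iFn : P.-integrable setT (EFin \o (fun w => `|F (Zs 0%N w, Y w)| ^+ n)).

Definition section_mean y := \int[mu]_z F (z, y).
Definition centered z := F z - section_mean z.2.

Local Notation g := section_mean.
Local Notation H := centered.
Local Notation S := (partial_sum Zs Y H).

Lemma integrable_copy k : P.-integrable setT (EFin \o (fun w => F (Zs k w, Y w))).
Proof.
by have := integrable_sectionX Zs_indep ZsY_indep Zs_law mF n iFn k 1; apply; lia.
Qed.

Let mg : measurable_fun [set: T2] g.
Proof.
apply: (measurable_fun_section_mean
  (independent_Zs_Y Zs_indep ZsY_indep 0) (Zs_law 0%N) F mF).
exact: integrable_copy.
Qed.

Let mgY : measurable_fun [set: T] (fun w => g (Y w)).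
Proof. exact: measurableT_comp. Qed.

Let mH : measurable_fun [set: T1 * T2] H.
Proof. by apply: measurable_funB => //; exact: measurableT_comp. Qed.

Let ign : P.-integrable setT (EFin \o (fun w => `|g (Y w)| ^+ n)).
Proof.
apply: (eq_integrable measurableT _ _ _ (integrable_norm
  (integrable_meanX Zs_indep ZsY_indep Zs_law mF n iFn))).
by move=> w _; rewrite /= normrX.
Qed.

Let iHn : P.-integrable setT (EFin \o (fun w => `|H (Zs 0%N w, Y w)| ^+ n)).
Proof.
apply: (integrable_le (integrable_mulrl (2 ^+ n) (integrable_addr iFn ign))).
  apply/measurable_funX/measurableT_comp => //; apply: measurableT_comp => //.
  exact: measurable_fun_pair.
move=> w; rewrite normrX normr_id -(normrN (g _)); exact: normr_exprD_le.
Qed.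

Let iHX k i : (i <= n)%N ->
  P.-integrable setT (EFin \o (fun w => H (Zs k w, Y w) ^+ i)).
Proof. exact: (integrable_sectionX Zs_indep ZsY_indep Zs_law mH n iHn). Qed.

(** The mean of the difference can be split only where the section of [F] is integrable, hence the
    almost sure form. *)
Let centered_mean0 : {ae P, forall w, section_moment mu H 1 (Y w) = 0}.
Proof.
have := ae_section_integrable (independent_Zs_Y Zs_indep ZsY_indep 0)
  (Zs_law 0%N) F mF (integrable_copy 0).
apply: filterS => w iw; rewrite /section_moment /centered/=.
under eq_Rintegral do rewrite expr1.
rewrite RintegralB//; last exact: finite_measure_integrable_cst.
by rewrite Rintegral_cst//= (@probability_setT _ _ _ mu) mulr1 subrr.
Qed.

Lemma average_centered K w : (0 < K)%N ->
  K%:R^-1 * \sum_(k < K) F (Zs k w, Y w) = g (Y w) + K%:R^-1 * S K w.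
Proof.
move=> K0; rewrite /partial_sum /centered/= sumrB sumr_const card_ord.
rewrite mulrBr -[X in _ - _ * X]mulr_natl mulKf ?pnatr_eq0 -?lt0n//.
by rewrite addrCA subrr addr0.
Qed.

Let weight_cst m : (m <= n)%N -> moment_weight Zs Y H m (fun=> 1).
Proof.
move=> mn; split; first exact: measurable_cst.
by under eq_fun do rewrite /= mul1r; exact: iHX.
Qed.

Let newton_Sm m G : (m <= n)%N -> moment_weight Zs Y H m G ->
  newton (m./2).+1 (fun K => \int[P]_w (G (Y w) * S K w ^+ m)).
Proof.
exact: (newton_moment Zs_indep ZsY_indep Zs_law mH n iHn centered_mean0).
Qed.

Let integrable_weightS m G K : moment_weight Zs Y H m G ->
  P.-integrable setT (EFin \o (fun w => `|G (Y w)| * `|S K w| ^+ m)).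
Proof. exact: (integrable_partial_sumX Zs_indep ZsY_indep Zs_law mH m G K). Qed.

Let mS K : measurable_fun [set: T] (S K).
Proof. exact: (measurable_partial_sum mH K). Qed.

(** [K^-m] times a polynomial of degree at most [m/2] is O(K^-s) once [s <= m - m/2]. The pair
    [(m, s)] is [(2, 1)] in the strong error and [(2r, r)] in the Taylor remainder. *)
Let bounded_newton m s (G : T2 -> R) : (m <= n)%N -> (s + (m./2).+1 <= m.+1)%N ->
  moment_weight Zs Y H m G ->
  exists2 M, 0 <= M & forall K, (0 < K)%N ->
    K%:R^-1 ^+ m * \int[P]_w (G (Y w) * S K w ^+ m) <= M * K%:R^-1 ^+ s.
Proof.
move=> mn sm wG; have [q Hq] := newton_inv_poly _ _ _ _ sm (newton_Sm _ _ mn wG).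
exists (\sum_(i < size q) `|q`_i|); first exact: sumr_ge0.
move=> K K0; rewrite Hq// [leRHS]mulrC ler_wpM2l ?exprn_ge0 ?invr_ge0//.
apply: (le_trans (ler_norm _)); apply: horner_le_sum.
have sK : steps (K%:R^-1 : R) by exists K.
by have /andP[/ltW -> ->] := steps_itv _ sK.
Qed.

Context {f : R -> R} {L : R}.
Hypothesis f_lip : forall x y, `|f x - f y| <= L * `|x - y|.

Let L0 : 0 <= L.
Proof. by have := f_lip 1 0; rewrite subr0 normr1 mulr1; apply: le_trans. Qed.

Hypothesis cf : continuous f.

Let mf : measurable_fun [set: R] f.
Proof. exact: continuous_measurable_fun. Qed.

Lemma nested_strong_error : exists2 V, 0 <= V & forall K, (0 < K)%N ->
  (\int[P]_w (`|f (g (Y w) + K%:R^-1 * S K w) - f (g (Y w))| ^+ 2)%:E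
   <= (V * K%:R^-1)%:E)%E.
Proof.
have n2 : (2 <= n)%N by lia.
have [M M0 HM] := bounded_newton 2 1 _ n2 isT (weight_cst 2 n2).
exists (L ^+ 2 * M) => [|K K0]; first by rewrite mulr_ge0 ?exprn_ge0.
have iS2 : P.-integrable setT (EFin \o (fun w => 1 * S K w ^+ 2)).
  apply: (integrable_le (integrable_weightS 2 _ K (weight_cst 2 n2))).
    by apply: measurable_funM => //; exact: measurable_funX.
  by move=> w; rewrite normrM normrX.
apply: (@le_trans _ _ (\int[P]_w ((L ^+ 2 * K%:R^-1 ^+ 2) * (1 * S K w ^+ 2))%:E)%E).
  apply: ge0_le_integral => //.
  - apply/measurable_EFinP/measurable_funX/measurableT_comp => //.
    apply: measurable_funB; last exact: measurableT_comp.
    by apply: measurableT_comp => //; apply: measurable_funD => //; exact: measurable_funM.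
  - apply/measurable_EFinP; apply: measurable_funM => //.
    by apply: measurable_funM => //; exact: measurable_funX.
  - move=> w _; rewrite lee_fin mul1r -!exprMn -[leRHS]real_normK ?num_real//.
    rewrite lerXn2r ?nnegrE// (le_trans (f_lip _ _))// addrAC subrr add0r.
    by rewrite -mulrA [in leRHS]normrM (ger0_norm L0).
under eq_integral do rewrite EFinM.
rewrite integralZl// -[X in (_ * X)%E]fineK ?integrable_fin_num//.
rewrite -EFinM lee_fin -(mulrA (L ^+ 2)) -(mulrA (L ^+ 2) M).
rewrite ler_wpM2l ?exprn_ge0//.
by have := HM K K0; rewrite expr1.
Qed.

Context {M : R}.
Hypothesis M0 : 0 <= M.
Hypothesis df : forall k, (k < n)%N -> forall x : R, derivable (derive1n k f) x 1.
Hypothesis f_growth : forall k, (k <= n)%N ->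
  forall x, `|derive1n k f x| <= M * (1 + `|x|) ^+ (r - k).

(** A derivative of order below [n] is differentiable, hence continuous. The derivative of order [n]
    enters only through its bound. *)
Let mdf k : (k < n)%N -> measurable_fun [set: R] (derive1n k f).
Proof.
move=> kn; apply: continuous_measurable_fun => x.
exact/differentiable_continuous/derivable1_diffP/df.
Qed.

Let weight_derive k : (k < n)%N -> moment_weight Zs Y H k (fun y => derive1n k f (g y)).
Proof.
move=> kn; have mG := measurableT_comp (mdf k kn) mg.
(* With truncated subtraction [q] is the maximum of [r] and [k], so at most [n]. The product of
   [(1 + |g|)^(r - k)] and [|H|^k] is bounded by the sum of the powers of order [q], which are
   integrable. *)
split => //; pose q := (r - k + k)%N.
have qn : (q <= n)%N by rewrite /q; lia.
have i1 := finite_measure_integrable_cst P 1 measurableT.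
apply: (integrable_le (integrable_mulrl M (integrable_addr
  (integrable_mulrl (2 ^+ n) (integrable_addr i1 ign)) (integrable_addr i1 iHn)))).
  apply: measurable_funM; first exact: (measurableT_comp mG).
  apply: measurable_funX; apply: measurableT_comp => //.
  exact: measurable_fun_pair.
move=> w; rewrite normrM normrX.
apply: le_trans (ler_wpM2r (exprn_ge0 _ (normr_ge0 _)) (f_growth _ (ltnW kn) _)) _.
rewrite -mulrA ler_wpM2l//; set x := g (Y w); set y := H _.
have x1 : 0 <= 1 + `|x| by rewrite addr_ge0.
have := normr_exprM_le (1 + `|x|) y (r - k) k.
rewrite (ger0_norm x1) => /le_trans; apply; apply: lerD.
  apply: (@le_trans _ _ ((1 + `|x|) ^+ n)); first by rewrite ler_weXn2l// lerDl.
  have := normr_exprD_le 1 `|x| n.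
  by rewrite (ger0_norm x1) normr_id normr1 expr1n.
have [y1|/ltW y1] := leP `|y| 1.
  by rewrite (@le_trans _ _ 1)//= ?exprn_ile1// lerDl exprn_ge0.
by rewrite (le_trans (ler_weXn2l y1 qn))//= lerDr.
Qed.

Lemma nested_integrable K : (0 < K)%N ->
  P.-integrable setT (EFin \o (fun w => f (g (Y w) + K%:R^-1 * S K w))).
Proof.
move=> K0; have iavg : P.-integrable setT
    (EFin \o (fun w => g (Y w) + K%:R^-1 * S K w)).
  under eq_fun do rewrite /= -average_centered//.
  apply: integrable_mulrl; apply: integrable_sumr => k _; exact: integrable_copy.
have i0 := finite_measure_integrable_cst P `|f 0| measurableT.
apply: (integrable_le (integrable_addr i0
  (integrable_mulrl L (integrable_norm iavg)))).
  by apply: measurableT_comp => //; exact/measurable_EFinP/(measurable_int _ iavg).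
move=> w /=; set x := g _ + _.
rewrite -[f x](subrK (f 0)) addrC (le_trans (ler_normD _ _))// lerD2l.
by rewrite (le_trans (f_lip _ _))// subr0.
Qed.

Lemma nested_weak_error : exists (q : {poly R}) (B : R), 0 <= B /\
  forall K, (0 < K)%N ->
  `|\int[P]_w f (g (Y w) + K%:R^-1 * S K w) - \int[P]_w f (g (Y w))
    - K%:R^-1 * q.[K%:R^-1]| <= B * K%:R^-1 ^+ r.
Proof.
pose A k K := \int[P]_w (derive1n k f (g (Y w)) * S K w ^+ k).
(* This splits off the Taylor term of order 0, which is E[f(g(Y))]; the orders 1 to [n - 1] are
   [k.+1] with [k < n']. *)
have [n' nE] : exists n', n = n'.+1 by exists n.-1; lia.
(* The moment of order [k + 1] has degree at most [(k + 1)/2] in [K], rounded down, hence at most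
   [k]: a factor [1/K] can be taken out of each term. *)
have /choice[q Hq] : forall k, exists q : {poly R}, (k < n')%N ->
    forall K, (0 < K)%N ->
    K%:R^-1 ^+ k.+1 * A k.+1 K = K%:R^-1 ^+ 1 * q.[K%:R^-1].
  move=> k; have [kn|_] := ltnP k n'; last by exists 0.
  have kn1 : (k.+1 < n)%N by rewrite nE.
  have sk : (1 + (k.+1./2).+1 <= k.+2)%N by lia.
  have [q Hq] := newton_inv_poly _ _ _ _ sk
    (newton_Sm _ _ (ltnW kn1) (weight_derive _ kn1)).
  by exists q.
have sn : (r + (n./2).+1 <= n.+1)%N by lia.
have [B B0 HB] := bounded_newton n r _ (leqnn n) sn (weight_cst n (leqnn n)).
(* The weights are the Taylor coefficients [1/(k + 1)!]; the constant is the bound on the derivative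
   of order [n] times the one on the moment of order [n]. *)
exists (\sum_(k < n') (k.+1`!%:R^-1) *: q k), (M * B); split.
  by rewrite mulr_ge0.
move=> K K0; set h : R := K%:R^-1.
have h0 : 0 <= h by rewrite invr_ge0.
pose term k w := (h ^+ k / k`!%:R) * (derive1n k f (g (Y w)) * S K w ^+ k).
have iT k : (k < n)%N -> P.-integrable setT
    (EFin \o (fun w => derive1n k f (g (Y w)) * S K w ^+ k)).
  move=> kn; have wk := weight_derive k kn.
  apply: (integrable_le (integrable_weightS _ _ K wk)) => [|w].
    apply: measurable_funM; last exact: measurable_funX.
    by have [mG _] := wk; exact: (measurableT_comp mG).
  by rewrite normrM normrX.
have iterm (k : 'I_n) : P.-integrable setT (EFin \o term k).
  by apply: integrable_mulrl; exact: iT.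
pose rem w := f (g (Y w) + h * S K w) - \sum_(k < n) term k w.
have isum : P.-integrable setT (EFin \o (fun w => \sum_(k < n) term k w)).
  by apply: integrable_sumr => k _; exact: iterm.
have irem : P.-integrable setT (EFin \o rem).
  by have := integrableB measurableT (nested_integrable K K0) isum.
(* The polynomial part is exactly the mean of the Taylor terms of orders 1 to [n - 1], so only the
   mean of the remainder is left to bound. *)
have int_rem : \int[P]_w f (g (Y w) + h * S K w) - \int[P]_w f (g (Y w))
    - h * (\sum_(k < n') (k.+1`!%:R^-1) *: q k).[h] = \int[P]_w rem w.
  rewrite /rem RintegralB//; last exact: nested_integrable.
  rewrite (Rintegral_sum _ _ (fun k : 'I_n => term k))//.
  rewrite -addrA -opprD; congr (_ - _).
  rewrite (eq_bigr (fun k : 'I_n => h ^+ k / k`!%:R * A k K)); last first.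
    by move=> k _; rewrite RintegralZl//; exact: iT.
  rewrite -(big_mkord xpredT (fun k => h ^+ k / k`!%:R * A k K)) nE.
  rewrite big_mkord big_ord_recl/= expr0 fact0 divr1 mul1r; congr (_ + _).
    by apply: eq_Rintegral => w _; rewrite expr0 mulr1.
  rewrite horner_sum mulr_sumr; apply: eq_bigr => k _.
  by rewrite hornerZ /bump/= mulrAC (Hq k (ltn_ord k) K K0) -/h expr1; ring.
rewrite int_rem (le_trans (le_normr_Rintegral _ _))//.
have iSn : P.-integrable setT (EFin \o (fun w => 1 * S K w ^+ n)).
  apply: (integrable_le (integrable_weightS n _ K (weight_cst n (leqnn n)))).
    by apply: measurable_funM => //; exact: measurable_funX.
  by move=> w; rewrite normrM normrX.
apply: (@le_trans _ _ (\int[P]_w ((M * h ^+ n) * (1 * S K w ^+ n)))).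
  apply: le_Rintegral => //; [exact: integrable_norm|exact: integrable_mulrl|].
  move=> w _.
  have fn x : `|derive1n n f x| <= M.
    by have := f_growth n (leqnn n) x; rewrite (_ : (r - n)%N = 0%N) ?mulr1//; lia.
  have := taylor_remainder_le n f M df fn (g (Y w)) (h * S K w).
  rewrite /rem /term mul1r -mulrA -exprMn.
  (* The exponent [n = 2r] is even, so the absolute value disappears and a moment of [S_K]
     remains. *)
  rewrite [X in _ <= _ * X](_ : _ = (h * S K w) ^+ n); last first.
    by rewrite !exprM real_normK// num_real.
  apply: le_trans; rewrite le_eqVlt; apply/orP; left; apply/eqP.
  congr (`|_ - _|); apply: eq_bigr => k _; rewrite exprMn; ring.
rewrite RintegralZl// -!mulrA ler_wpM2l//; exact: HB.
Qed.

End nested_monte_carlo.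

(** * From the section mean to the given version of the conditional expectation *)

Theorem proposition4p3 (R : realType) (d : measure_display)
  (T : measurableType d) (P : probability T R) (qZ qY : nat)
  (X : {RV P >-> R}) (Y : {RV P >-> qY.-tuple R}) (Z : {RV P >-> qZ.-tuple R})
  (F : qZ.-tuple R * qY.-tuple R -> R) (Zs : nat -> {RV P >-> qZ.-tuple R})
  (f : R -> R) (C : T -> R) (Yfam : R -> T -> R) (r : nat)
  (X_L2 : (X : T -> R) \in Lfun P 2%:E)
  (F_borel : measurable_fun [set: qZ.-tuple R * qY.-tuple R] F)
  (Z_indep_Y : independent_RVs Z Y)
  (X_def : forall w, X w = F (Z w, Y w))
  (Zs_iid : iid_copies Zs Z)
  (Zs_indep_Y : sequence_independent_of Zs Y)
  (C_cond : is_cond_expectation X Y C)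
  (Yfam_def : is_nested_family f F (fun k => Zs k) Y C Yfam)
  (r_ge2 : (2 <= r)%N)
  (X_L2r : (X : T -> R) \in Lfun P (2 * r)%:R%:E)
  (f_lip : lipschitz f)
  (f_diff : forall k, (k < 2 * r)%N -> forall x : R, derivable (derive1n k f) x 1)
  (f_bounded : forall k, (r <= k <= 2 * r)%N ->
    [bounded derive1n k f x | x in [set: R]]) :
  strong_error P Yfam 1 /\ weak_error P Yfam 1 r.-1.
Proof.
pose mu : probability _ R := distribution P Z.
have [Zs_indep Zs_same] := Zs_iid.
have Zs_law k B : measurable B -> P (Zs k @^-1` B) = mu B by exact: Zs_same.
have Z_law B : measurable B -> P (Z @^-1` B) = mu B by [].
have r0 : (0 < r)%N by exact: leq_trans r_ge2.
have mX : measurable_fun [set: T] X by exact: measurable_funP.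
have iXn : P.-integrable setT (EFin \o (fun w => `|F (Z w, Y w)| ^+ (2 * r))).
  have n1 : 1 <= (2 * r)%:R :> R by rewrite ler1n muln_gt0.
  apply: (eq_integrable measurableT _ _ _ (Lfun_integrable n1 X_L2r)).
  by move=> w _; rewrite /= powR_mulrn// X_def.
have mFn : measurable_fun [set: qZ.-tuple R * qY.-tuple R]
    (fun z => `|F z| ^+ (2 * r)).
  by apply: measurable_funX; exact: measurableT_comp.
(* The moment passes from [Z] to the first copy: paired with [Y], both have as joint law the product
   of [mu] and the law of [Y]. *)
have iFn : P.-integrable setT
    (EFin \o (fun w => `|F (Zs 0%N w, Y w)| ^+ (2 * r))).
  have ZsY := independent_Zs_Y Zs_indep Zs_indep_Y 0.
  apply/(integrable_independent_pair ZsY (Zs_law 0%N) _ mFn).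
  exact/(integrable_independent_pair Z_indep_Y Z_law _ mFn).
have iX : P.-integrable setT (EFin \o X).
  apply/Lfun1_integrable; apply: Lfun_subset12 X_L2.
  by rewrite fin_num_measure.
(* [Yfam 0] is built from [C], while the estimates concern [g(Y)]; this almost sure equality
   transfers both errors. *)
have C_ae := cond_expectation_section_mean Z_indep_Y Z_law F_borel X_def C_cond iX.
have [C_L1 _ _] := C_cond.
have mC : measurable_fun [set: T] C.
  by move/Lfun1_integrable : C_L1 => /(measurable_int _)/measurable_EFinP.
have [L _ f_L] := pinfty_ex_gt0 f_lip.
have fL x y : `|f x - f y| <= L * `|x - y| by exact: (f_L (x, y) (conj I I)).
have f_cont : continuous f.
  move=> x; apply/differentiable_continuous/derivable1_diffP.
  by apply: (f_diff 0%N); rewrite muln_gt0.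
have rn : (r <= 2 * r)%N by rewrite leq_pmull.
have [M M0 f_growth] := derive1n_growth _ _ _ rn f_diff f_bounded.
have [Y0 YK] := Yfam_def.
pose g := section_mean (mu := mu) (F := F).
pose S := partial_sum Zs Y (centered (mu := mu) (F := F)).
have YKE K : (0 < K)%N -> Yfam K%:R^-1 = fun w => f (g (Y w) + K%:R^-1 * S K w).
  move=> K0; apply/funext => w; rewrite YK//; congr f.
  exact: average_centered.
have f_meas : measurable_fun [set: R] f by exact: continuous_measurable_fun.
have mfg : measurable_fun [set: T] (fun w => f (g (Y w))).
  apply: measurableT_comp => //; apply: measurableT_comp => //.
  apply: (measurable_fun_section_mean Z_indep_Y Z_law F F_borel).
  by apply: eq_integrable iX => // w _ /=; rewrite X_def.
have Y0E : Yfam 0 = fun w => f (C w) by apply/funext.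
have iY0 : P.-integrable setT (EFin \o Yfam 0).
  rewrite Y0E; have i0 := finite_measure_integrable_cst P `|f 0| measurableT.
  have iC : P.-integrable setT (EFin \o C) by exact/Lfun1_integrable.
  apply: (integrable_le (integrable_addr i0
    (integrable_mulrl L (integrable_norm iC)))).
    exact: measurableT_comp.
  move=> w /=; rewrite -[f (C w)](subrK (f 0)) addrC.
  by rewrite (le_trans (ler_normD _ _))// lerD2l (le_trans (fL _ _))// subr0.
have iYK K : (0 < K)%N -> P.-integrable setT (EFin \o Yfam K%:R^-1).
  move=> K0; rewrite YKE//.
  exact: (nested_integrable Zs_indep Zs_indep_Y Zs_law F_borel r0 iFn fL f_cont K K0).
have iY h : (@steps R `|` [set 0]) h -> P.-integrable setT (EFin \o Yfam h).
  by move=> [[K K0 ->]|->]; [exact: iYK|exact: iY0].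
split; split.
- by move=> h /iY /(measurable_int _)/measurable_EFinP.
- have [V V0 HV] := nested_strong_error Zs_indep Zs_indep_Y Zs_law F_borel r0 iFn
    fL f_cont.
  exists V => // h [K K0 ->]; rewrite powRr1// unlock.
  apply: le_trans (HV K K0); rewrite le_eqVlt; apply/orP; left; apply/eqP.
  have mYK : measurable_fun [set: T] (fun w => f (g (Y w) + K%:R^-1 * S K w)).
    by have /(measurable_int _)/measurable_EFinP := iYK K K0; rewrite YKE.
  apply: ae_eq_integral => //.
  + apply/measurable_EFinP/measurable_funX/measurableT_comp => //.
    by apply: measurable_funB; rewrite ?YKE// Y0E; exact: measurableT_comp.
  + apply/measurable_EFinP/measurable_funX/measurableT_comp => //.
    exact: measurable_funB.
  + by apply: filterS C_ae => w Cw _; rewrite YKE// Y0E Cw.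
- by move=> h /iY /Lfun1_integrable.
have [q [B [B0 HB]]] := nested_weak_error Zs_indep Zs_indep_Y Zs_law F_borel r0 iFn
  fL f_cont M0 f_diff f_growth.
pose e h := \int[P]_w Yfam h w - \int[P]_w Yfam 0 w.
(* The error of order [r] is read as [h^(s + 1)] with [s = r - 1], the number of terms of the
   expansion. *)
have eB h : steps h -> `|e h - h * q.[h]| <= B * h ^+ r.-1.+1.
  move=> [K K0 ->]; rewrite prednK//; apply: le_trans (HB K K0).
  rewrite le_eqVlt; apply/orP; left; apply/eqP.
  rewrite /e YKE// Y0E; congr (`|_ - _ - _|).
  rewrite /Rintegral; congr fine; apply: ae_eq_integral => //.
  - by apply/measurable_EFinP; exact: measurableT_comp.
  - exact/measurable_EFinP.
  - by apply: filterS C_ae => w /= -> _.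
have [c [eta [e_eq eta0]]] := inverse_integer_expansion e q B r.-1 B0 eB.
exists c, eta; split=> // h sh; rewrite -(e_eq h sh) unlock.
have fin h' : (@steps R `|` [set 0]) h' ->
    (\int[P]_w (Yfam h' w)%:E = (\int[P]_w Yfam h' w)%:E)%E.
  by move=> /iY iYh; rewrite fineK// integrable_fin_num.
rewrite fin; last by left.
by rewrite fin; [rewrite -EFinD addrC subrK|right].
Qed.
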